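(* Let $n\ge 2$ be an integer and $0<\alpha<1$. Let $\bar\Sigma\in\mathbb{R}^{n\times n}$ be a symmetric matrix such that $\bar\Sigma_{ij}=\alpha^{\max(i,j)}$ for all $(i,j)$ with $|i-j|\le 1$. Then the $n\times n$ first-order stable spline kernel $\mathcal{K}$, $\mathcal{K}_{ij}=\alpha^{\max(i,j)}$ for $1\le i,j\le n$, maximizes the likelihood among all covariance matrices satisfying the conditional independence constraints $(\Sigma^{-1})_{ij}=0$ for $|i-j|>1$; that is, $\mathcal{K}$ solves $$\text{minimize }\ \log\det\Sigma+\operatorname{trace}\left(\bar\Sigma\,\Sigma^{-1}\right)\quad\text{over symmetric }\Sigma\in\mathbb{R}^{n\times n}\quad\text{subject to }\ \Sigma\succeq 0,\qquad (\Sigma^{-1})_{ij}=0\ \text{ for all }(i,j)\text{ with }|i-j|>1 .$$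
   Context: $\Sigma\succeq 0$ means that $\Sigma$ is positive semidefinite; since $\Sigma^{-1}$ appears in the objective and constraints, $\Sigma$ ranges over invertible (hence positive definite) matrices. Maximizing the likelihood means minimizing the displayed objective, which is, up to positive scaling and additive constants, the negative log-likelihood of a zero-mean Gaussian vector $\theta=(\theta_1,\dots,\theta_n)^\top$ with covariance $\Sigma$ and sample covariance $\bar\Sigma$. The constraint $(\Sigma^{-1})_{ij}=0$ expresses that $\theta_i$ and $\theta_j$ are conditionally independent given the other components. *)

(* Defs.v *)
From mathcomp Require Import all_boot all_order all_algebra.
From mathcomp Require Import all_classical all_reals all_analysis.

Set Implicit Arguments.
Unset Strict Implicit.
Unset Printing Implicit Defensive.

Import Order.TTheory GRing.Theory Num.Theory.
Local Open Scope ring_scope.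

Definition psdmx (R : realType) (n : nat) (S : 'M[R]_n) : Prop :=
  S \is symmetricmx /\ forall x : 'cV[R]_n, 0 <= (x^T *m S *m x) 0 0.

(* Ordinals start at 0, whence the successors. *)
Definition stable_spline_kernel (R : realType) (n : nat) (alpha : R) : 'M[R]_n :=
  \matrix_(i < n, j < n) alpha ^+ maxn i.+1 j.+1.

(* Negative log-likelihood, up to a positive factor and an additive constant, of
   the covariance S of a zero-mean Gaussian vector with sample covariance Sbar. *)
Definition neg_loglik (R : realType) (n : nat) (Sbar S : 'M[R]_n) : R :=
  ln (\det S) + \tr (Sbar *m invmx S).

(* Invertibility is the implicit domain of the problem; it must be explicit
   because invmx S = S and ln (\det S) = 0 when S is singular. *)
Definition feasible (R : realType) (n : nat) (S : 'M[R]_n) : Prop :=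
  [/\ psdmx S, S \in unitmx &
      forall i j : 'I_n, (1 < `|i - j|)%N -> invmx S i j = 0].

Definition is_minimizer (R : realType) (T : Type)
    (F : T -> Prop) (f : T -> R) (x : T) : Prop :=
  F x /\ forall y : T, F y -> f x <= f y.

(* Main.v *)
Require Import Defs.
From mathcomp Require Import all_boot all_order all_algebra.
From mathcomp Require Import all_classical all_reals all_analysis.
From mathcomp Require Import zify ring lra.

Set Implicit Arguments.
Unset Strict Implicit.
Unset Printing Implicit Defensive.

Import Order.TTheory GRing.Theory Num.Theory.
Local Open Scope ring_scope.

(** The stable spline kernel factors as K = B B^T with B upper triangular and
    B^-1 upper bidiagonal, so K is positive definite and K^-1 is tridiagonal.
    For a feasible S, S^-1 is tridiagonal too, so only the tridiagonal band of
    Sbar matters and tr (Sbar S^-1) = tr (K S^-1) = tr (B^T S^-1 B). The claim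
    thus reduces to ln (det M) <= tr M - n for the positive definite matrix
    M = B^T S^-1 B, which follows by induction on n via Schur complements. *)

Lemma symmetricmxE (F : fieldType) n (M : 'M[F]_n) :
  (M \is symmetricmx) = (M == M^T).
Proof. by rewrite is_hermitianmxE expr0 scale1r map_mx_id. Qed.

Lemma psdmx_congr (R : realType) m n (S : 'M[R]_n) (A : 'M[R]_(n, m)) :
  psdmx S -> psdmx (A^T *m S *m A).
Proof.
case; rewrite symmetricmxE => /eqP symS posS; split.
  by rewrite symmetricmxE !trmx_mul trmxK -symS mulmxA.
by move=> x; have := posS (A *m x); rewrite trmx_mul !mulmxA.
Qed.

Lemma psdmx_gram (R : realType) m n (A : 'M[R]_(n, m)) : psdmx (A *m A^T).
Proof.
split; first by rewrite symmetricmxE trmx_mul trmxK.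
move=> x; rewrite -mulmxA -(mulmxA A) mulmxA.
have -> : x^T *m A = (A^T *m x)^T by rewrite trmx_mul trmxK.
by rewrite mxE; apply: sumr_ge0 => i _; rewrite mxE -expr2 sqr_ge0.
Qed.

(** By symmetry [invmx S] is the congruence of [S] by [invmx S] itself. *)
Lemma psdmx_inv (R : realType) n (S : 'M[R]_n) :
  psdmx S -> S \in unitmx -> psdmx (invmx S).
Proof.
move=> psdS uS; have := psdmx_congr (invmx S) psdS; rewrite trmx_inv.
by case: psdS; rewrite symmetricmxE => /eqP <- _; rewrite mulVmx // mul1mx.
Qed.

Lemma psdmx_diag_ge0 (R : realType) n (S : 'M[R]_n) i : psdmx S -> 0 <= S i i.
Proof.
case=> _ /(_ (delta_mx i 0)); rewrite trmx_delta -rowE -colE.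
by rewrite !mxE.
Qed.

Lemma psdmx_diag_eq0 (R : realType) n (S : 'M[R]_n) i :
  psdmx S -> S i i = 0 -> row i S = 0.
Proof.
move=> [symS posS] Sii; apply/rowP => j; rewrite !mxE.
have Sji : S j i = S i j.
  by move: symS; rewrite symmetricmxE => /eqP symS; rewrite [in LHS]symS mxE.
(* The quadratic form is affine along t e_i + e_j; t makes its value -1. *)
pose t := - (S j j + 1) / (S i j *+ 2).
have := posS (t *: delta_mx i 0 + delta_mx j 0).
have -> : (t *: delta_mx i 0 + delta_mx j 0 : 'cV[R]_n)^T =
    t *: delta_mx 0 i + delta_mx 0 j by rewrite linearD linearZ /= !trmx_delta.
rewrite !(mulmxDl, mulmxDr) -!(scalemxAl, scalemxAr).
rewrite -!rowE -!colE !mxE Sii Sji.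
have [//|Sij] := eqVneq (S i j) 0.
have -> : t * (t * 0) + t * S i j + (t * S i j + S j j) = -1.
  by rewrite /t; field.
by rewrite ler0N1.
Qed.

Lemma ln_le_sub1 (R : realType) (x : R) : 0 < x -> ln x <= x - 1.
Proof.
move=> x0; have := @le_ln1Dx R (x - 1).
by rewrite [1 + _]addrC subrK; apply; lra.
Qed.

(** In terms of eigenvalues this sums ln x <= x - 1; here pivots replace eigenvalues. Positivity of
    the determinant is carried through the induction so that [ln] splits over the product of the
    first pivot and the remaining determinant. *)
Lemma psdmx_ln_det (R : realType) n (M : 'M[R]_n) :
  psdmx M -> M \in unitmx -> 0 < \det M /\ ln (\det M) <= \tr M - n%:R.
Proof.
elim: n M => [|n IHn] M psdM uM.
  by rewrite det_mx00 ln1 [\tr M]big_ord0 subrr.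
pose E (b : 'rV[R]_n) : 'M[R]_(1 + n) := block_mx 1%:M b 0 1%:M.
have detE b : \det (E b) = 1 by rewrite det_ublock !det1 mulr1.
move: M psdM uM; rewrite -[n.+1]/(1 + n)%N => M psdM uM.
(* A zero pivot would force a zero first row, contradicting invertibility. *)
have a_gt0 : 0 < M 0 0.
  rewrite lt_neqAle psdmx_diag_ge0 // andbT eq_sym; apply/eqP => M00.
  have /(congr1 (mulmxr (invmx M))) /= := psdmx_diag_eq0 psdM M00.
  rewrite rowE mulmxK // mul0mx => /matrixP /(_ 0 0) /eqP.
  by rewrite !mxE !eqxx oner_eq0.
have symM : M = M^T by case: psdM; rewrite symmetricmxE => /eqP.
set a := M 0 0 in a_gt0.
pose b := ursubmx M; pose C := drsubmx M.
have defM : M = block_mx a%:M b b^T C.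
  rewrite -[LHS]submxK; congr block_mx; last by rewrite /b trmx_ursub -symM.
  by rewrite [LHS]mx11_scalar !mxE; congr (M _ _)%:M; apply: val_inj.
pose S := C - a^-1 *: (b^T *m b).
(* Block elimination: this congruence of determinant 1 clears the off-diagonal blocks and leaves the
   Schur complement [S]. *)
have elimM : (E (- a^-1 *: b))^T *m M *m E (- a^-1 *: b) = block_mx a%:M 0 0 S.
  rewrite defM tr_block_mx !mulmx_block.
  rewrite !(trmx0, trmx1, mul0mx, mulmx0, mul1mx, mulmx1, add0r, addr0).
  rewrite mul_scalar_mx mul_mx_scalar ![(_ *: b)^T]linearZ /=.
  rewrite !scalerA mulrN divff ?gt_eqF //.
  by rewrite !scaleN1r !addNr mul0mx add0r -scalemxAl scaleNr addrC.
have psdS : psdmx S.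
  have := psdmx_congr (col_mx 0 1%:M) (psdmx_congr (E (- a^-1 *: b)) psdM).
  rewrite elimM tr_col_mx mul_row_block mul_row_col.
  by rewrite !(trmx0, trmx1, mul0mx, mulmx0, mul1mx, mulmx1, add0r).
have detM : \det M = a * \det S.
  have := congr1 determinant elimM.
  by rewrite !det_mulmx det_tr detE mul1r mulr1 det_ublock det_scalar1.
have [||detS lnS] := IHn S; first by [].
  by move: uM; rewrite !unitmxE detM unitrM => /andP[].
split; first by rewrite detM mulr_gt0.
have trM : \tr M = a + \tr S + a^-1 * \tr (b^T *m b).
  by rewrite defM mxtrace_block mxtrace_scalar linearB linearZ /=; ring.
(* This is the excess of the trace of [M] over [a + \tr S]; its sign gives the inequality. *)
have bb_ge0 : 0 <= a^-1 * \tr (b^T *m b).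
  apply: mulr_ge0; first by rewrite invr_ge0 ltW.
  rewrite mxtrace_mulC trace_mx11; apply: psdmx_diag_ge0; exact: psdmx_gram.
rewrite detM lnM ?posrE // trM -natr1.
have := ln_le_sub1 a_gt0; lra.
Qed.

(* The increments alpha^k - alpha^(k+1) of the kernel (with 1-based k), except
   for the last one, which is alpha^n. *)
Definition spline_weight (R : realType) (alpha : R) (n k : nat) : R :=
  alpha ^+ k.+1 - (if (k.+1 < n)%N then alpha ^+ k.+2 else 0).

(** The upper triangular all-ones matrix with columns scaled by the square roots of the weights. *)
Definition spline_factor (R : realType) (alpha : R) n : 'M[R]_n :=
  \matrix_(i, k) ((i <= k)%:R * Num.sqrt (spline_weight alpha n k)).

(** The inverse of [spline_factor], not a matrix of minors: summation is undone by differences of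
    neighbours, and the scaling by reciprocals. *)
Definition spline_cofactor (R : realType) (alpha : R) n : 'M[R]_n :=
  \matrix_(k, j) ((Num.sqrt (spline_weight alpha n k))^-1 *
                  ((k == j)%:R - (k.+1 == j)%:R)).

Section SplineKernel.
Variables (R : realType) (alpha : R) (n : nat).
Hypotheses (alpha_gt0 : 0 < alpha) (alpha_lt1 : alpha < 1).
Local Notation K := (stable_spline_kernel n alpha).
Local Notation B := (spline_factor alpha n).
Local Notation W := (spline_cofactor alpha n).

Lemma spline_weight_gt0 k : 0 < spline_weight alpha n k.
Proof.
rewrite /spline_weight; case: ifP => _; last by rewrite subr0 exprn_gt0.
by rewrite subr_gt0 [ltLHS]exprS gtr_pMl // exprn_gt0.
Qed.

Lemma sum_spline_weight m : (m < n)%N ->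
  \sum_(m <= k < n) spline_weight alpha n k = alpha ^+ m.+1.
Proof.
(* A discrete antiderivative of the weights; its value 0 at [n] accounts for the exceptional last
   weight. *)
move=> ltmn; pose f k : R := - (if (k < n)%N then alpha ^+ k.+1 else 0).
rewrite (telescope_sumr_eq f) ?(ltnW ltmn) //.
  by rewrite /f ltnn ltmn oppr0 opprK add0r.
by move=> k /andP[_ ltkn]; rewrite /f ltkn opprK addrC.
Qed.

(** Entry [(i, j)] of the product sums the weights over [k >= maxn i j], and this sum telescopes. *)
Lemma stable_spline_kernelE : K = B *m B^T.
Proof.
apply/matrixP => i j; rewrite !mxE maxnSS -sum_spline_weight; last first.
  by rewrite gtn_max !ltn_ord.
rewrite (big_nat_widenl _ 0) // big_mkord [in LHS]big_mkcond /=.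
apply: eq_bigr => k _; rewrite !mxE mulrACA -expr2.
rewrite sqr_sqrtr ?ltW ?spline_weight_gt0 //.
rewrite geq_max -natrM mulnb.
by case: ifP => _; rewrite ?mul1r ?mul0r.
Qed.

Lemma spline_factorK : B *m W = 1%:M.
Proof.
apply/matrixP => i j; rewrite !mxE.
transitivity (\sum_(k < n) ((i <= k)%N && (k == j))%:R
            - \sum_(k < n) ((i <= k)%N && (k.+1 == j)%N)%:R : R).
  rewrite -sumrB; apply: eq_bigr => k _; rewrite !mxE -mulrA mulVKf.
    by rewrite mulrBr -!natrM !mulnb.
  by rewrite gt_eqF // sqrtr_gt0 spline_weight_gt0.
have -> : \sum_(k < n) ((i <= k)%N && (k == j))%:R = (i <= j)%N%:R :> R.
  rewrite (bigD1 j) //= eqxx andbT big1 ?addr0 // => k /negPf ->.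
  by rewrite andbF.
have -> : \sum_(k < n) ((i <= k)%N && (k.+1 == j)%N)%:R = (i < j)%N%:R :> R.
  (* Column 0 has no predecessor [k], so both sides vanish there. *)
  case: j => -[|j] ltjn /=; first by rewrite big1 // => k _; rewrite andbF.
  rewrite (bigD1 (Ordinal (ltnW ltjn))) //= eqxx andbT big1 ?addr0 // => k.
  by rewrite -val_eqE /= eqSS => /negPf ->; rewrite andbF.
by rewrite leq_eqVlt -val_eqE; case: ltngtP => _; rewrite ?subrr ?subr0.
Qed.

Lemma invmx_stable_spline_kernel : invmx K = W^T *m W.
Proof.
have KW : K *m (W^T *m W) = 1%:M.
  rewrite stable_spline_kernelE mulmxA -(mulmxA B) -trmx_mul.
  by rewrite (mulmx1C spline_factorK) trmx1 mulmx1 spline_factorK.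
have [uK _] := mulmx1_unit KW.
by rewrite -[RHS](mulKmx uK) KW mulmx1.
Qed.

Lemma stable_spline_kernel_feasible : feasible K.
Proof.
split; first by rewrite stable_spline_kernelE; apply: psdmx_gram.
  have [uB _] := mulmx1_unit spline_factorK.
  by rewrite stable_spline_kernelE unitmx_mul unitmx_tr uB.
move=> i j ij; rewrite invmx_stable_spline_kernel mxE big1 // => k _.
rewrite !mxE -!val_eqE /=.
(* Row [k] of [W] lives on columns [k] and [k.+1], so it cannot meet both [i] and [j]. *)
have [/andP[/negPf -> /negPf ->]|/andP[/negPf -> /negPf ->]] :
  ((k != i :> nat) && (k.+1 != i)) \/ ((k != j :> nat) && (k.+1 != j)) by lia.
  by rewrite subrr mulr0 mul0r.
by rewrite subrr !mulr0.
Qed.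

End SplineKernel.

(** The trace pairs [A i j] with [X j i], which vanishes off the band. *)
Lemma mxtrace_band (R : realType) n (A B X : 'M[R]_n) :
    (forall i j : 'I_n, (`|i - j| <= 1)%N -> A i j = B i j) ->
    (forall i j : 'I_n, (1 < `|i - j|)%N -> X i j = 0) ->
  \tr (A *m X) = \tr (B *m X).
Proof.
move=> AB X0; apply: eq_bigr => i _; rewrite !mxE; apply: eq_bigr => j _.
have [ij|ij] := leqP `|i - j| 1; first by rewrite AB.
by rewrite X0 ?mulr0 // distnC.
Qed.

Theorem proposition4p2 (R : realType) (n : nat) (hn : (2 <= n)%N)
    (alpha : R) (halpha0 : 0 < alpha) (halpha1 : alpha < 1)
    (Sbar : 'M[R]_n) (hsym : Sbar \is symmetricmx)
    (hband : forall i j : 'I_n, (`|i - j| <= 1)%N ->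
       Sbar i j = alpha ^+ maxn i.+1 j.+1) :
  is_minimizer (@feasible R n) (neg_loglik Sbar)
    (stable_spline_kernel n alpha).
Proof.
have feasK := stable_spline_kernel_feasible n halpha0 halpha1.
split=> // S feasS; set K := stable_spline_kernel n alpha in feasK *.
have trE X : feasible X -> \tr (Sbar *m invmx X) = \tr (K *m invmx X).
  by case=> _ _ X0; apply: mxtrace_band X0 => i j /hband ->; rewrite mxE.
rewrite /neg_loglik !trE //.
have [psdK uK _] := feasK; have [psdS uS _] := feasS.
have [detK _] := psdmx_ln_det psdK uK; have [detS _] := psdmx_ln_det psdS uS.
(* At [K] the trace term is exactly [n], the constant in [psdmx_ln_det]. *)
rewrite mulmxV // mxtrace1.
have defK : K = _ := stable_spline_kernelE n halpha0 halpha1.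
set B := spline_factor alpha n in defK.
have uB : B \in unitmx by move: uK; rewrite defK unitmx_mul => /andP[].
have psdM := psdmx_congr B (psdmx_inv psdS uS).
have [|_] := psdmx_ln_det psdM.
  by rewrite !unitmx_mul unitmx_tr unitmx_inv uB uS.
have -> : \det (B^T *m invmx S *m B) = \det K / \det S.
  by rewrite defK !det_mulmx det_inv; ring.
(* Cyclicity of the trace reassembles [B *m B^T] into [K]. *)
rewrite -mulmxA mxtrace_mulC -mulmxA mxtrace_mulC -defK mxtrace_mulC.
rewrite ln_div ?posrE //; lra.
Qed.
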